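(* Let $h:\mathbb R^n\to\mathbb R$ be $\mu_h$-strongly convex ($\mu_h>0$) with $L_h$-Lipschitz gradient, let $a>\min_{x\in\mathbb R^n}h(x)$, and let $\Omega=\{x\in\mathbb R^n: h(x)\le a\}$. Then $$\mathrm{SB}_{\mathrm{FW}}(\Omega,\partial\Omega)\ge\frac{\mu_h}{2L_h},\qquad \mathrm{SB}_{\mathrm{FDFW}}(\Omega)\ge\frac{\mu_h}{2L_h}.$$
   Context: $T_\Omega(x)$ is the tangent cone of $\Omega$ at $x$, $\pi(C,\cdot)$ the Euclidean projection on $C$, $\pi_x(g)=\|\pi(T_\Omega(x),g)\|$. Slope bound. For a method $\mathcal M$ with set of possible directions $\mathcal M(x,g)$ at $x\in\Omega$ for the gradient $-g$ (with the convention $\mathcal M(x,g)=\{0\}$ when $\pi_x(g)=0$), $\mathrm{DSB}_{\mathcal M}(\Omega,x,g)=\inf_{d\in\mathcal M(x,g)}\frac{\langle g,d\rangle}{\pi_x(g)\|d\|}$ if $\pi_x(g)\neq0$ and $=1$ otherwise. For $P\subset\Omega$, $\mathrm{SB}_{\mathcal M}(\Omega,P)=\inf_{x\in P,\,g\in\mathbb R^n}\mathrm{DSB}_{\mathcal M}(\Omega,x,g)$, and $\mathrm{SB}_{\mathcal M}(\Omega)=\mathrm{SB}_{\mathcal M}(\Omega,\Omega)$. FW directions at $(x,g)$: $d^{\mathrm{FW}}=s-x$ with $s\in\mathrm{argmax}_{s\in\Omega}\langle s,g\rangle$. FDFW (Frank-Wolfe with in face directions) at $(x,g)$: $d^{\mathrm{FD}}\in\mathrm{argmax}\{\langle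 g,d\rangle: d\in\{d^A,d^{\mathrm{FW}}\}\}$, where $d^A=x-x_A$, $x_A\in\mathrm{argmin}\{\langle g,y\rangle: y\in\mathcal F(x)\}$ and $\mathcal F(x)$ is the minimal face of the convex set $\Omega$ containing $x$. *)

(* Defs.v *)
From mathcomp Require Import all_boot all_order all_algebra.
From mathcomp Require Import all_classical all_reals all_analysis.
Import Order.TTheory GRing.Theory Num.Theory.
Import numFieldNormedType.Exports.

Set Implicit Arguments.
Unset Strict Implicit.
Unset Printing Implicit Defensive.

Local Open Scope classical_set_scope.
Local Open Scope ring_scope.

(* The library norm `|u| on 'rV[R]_n is the sup norm, so the Euclidean
   structure is set up here.  Both norms induce the library topology, and the
   library's [differentiable], [closure] and [interior] are used unchanged. *)
Definition dot (R : realType) (n : nat) (u v : 'rV[R]_n) : R :=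
  \sum_(i < n) u 0 i * v 0 i.

Definition enorm (R : realType) (n : nat) (u : 'rV[R]_n) : R :=
  Num.sqrt (dot u u).

Definition gradient (R : realType) (n : nat) (h : 'rV[R]_n -> R)
    (x : 'rV[R]_n) : 'rV[R]_n :=
  \row_i 'D_(delta_mx 0 i) h x.

Definition strongly_convex (R : realType) (n : nat) (mu : R)
    (h : 'rV[R]_n -> R) : Prop :=
  forall (x y : 'rV[R]_n) (t : R), 0 <= t -> t <= 1 ->
    h (t *: x + (1 - t) *: y) <=
      t * h x + (1 - t) * h y - mu / 2 * t * (1 - t) * enorm (x - y) ^+ 2.

Definition lipschitz_gradient (R : realType) (n : nat) (L : R)
    (h : 'rV[R]_n -> R) : Prop :=
  (forall x : 'rV[R]_n, differentiable h x) /\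
  (forall x y : 'rV[R]_n,
     enorm (gradient h x - gradient h y) <= L * enorm (x - y)).

Definition boundary (T : topologicalType) (A : set T) : set T :=
  closure A `\` interior A.

Definition argmax (R : realType) (T : Type) (A : set T) (f : T -> R) : set T :=
  [set s | A s /\ forall y, A y -> f y <= f s].

Definition argmin (R : realType) (T : Type) (A : set T) (f : T -> R) : set T :=
  [set s | A s /\ forall y, A y -> f s <= f y].

(* Tangent cone of convex analysis: closure of the cone of feasible
   directions. *)
Definition tangent_cone (R : realType) (n : nat) (Omega : set 'rV[R]_n)
    (x : 'rV[R]_n) : set 'rV[R]_n :=
  closure [set t *: (y - x) | t in [set t : R | 0 <= t] & y in Omega].

(* The default value 0 is irrelevant for a nonempty closed convex [C], where
   the closest point exists and is unique. *)
Definition proj (R : realType) (n : nat) (C : set 'rV[R]_n)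
    (g : 'rV[R]_n) : 'rV[R]_n :=
  xget 0 (argmin C (fun p => enorm (g - p))).

Definition pi_ (R : realType) (n : nat) (Omega : set 'rV[R]_n)
    (x g : 'rV[R]_n) : R :=
  enorm (proj (tangent_cone Omega x) g).

Definition is_face (R : realType) (n : nat) (Omega F : set 'rV[R]_n) : Prop :=
  [/\ F `<=` Omega, convex_set F &
      forall (y z : 'rV[R]_n) (t : R), Omega y -> Omega z -> 0 < t -> t < 1 ->
        F (t *: y + (1 - t) *: z) -> F y /\ F z].

(* Faces are stable under intersection, so for convex [Omega] containing [x]
   this is itself a face. *)
Definition minimal_face (R : realType) (n : nat) (Omega : set 'rV[R]_n)
    (x : 'rV[R]_n) : set 'rV[R]_n :=
  \bigcap_(F in [set F | is_face Omega F /\ F x]) F.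

(* [M Omega x g] is the set of possible directions of the method [M] over the
   feasible set [Omega] at the point [x] for the gradient [- g]. *)
Definition fw_method (R : realType) (n : nat) : Type :=
  set 'rV[R]_n -> 'rV[R]_n -> 'rV[R]_n -> set 'rV[R]_n.

Definition zero_if_stationary (R : realType) (n : nat) (M : fw_method R n) :
    fw_method R n :=
  fun Omega x g => [set d | if pi_ Omega x g == 0 then d = 0 else M Omega x g d].

Definition FW_directions (R : realType) (n : nat) : fw_method R n :=
  fun Omega x g => [set s - x | s in argmax Omega (fun s => dot s g)].

Definition in_face_directions (R : realType) (n : nat) : fw_method R n :=
  fun Omega x g =>
    [set x - xA | xA in argmin (minimal_face Omega x) (fun y => dot g y)].

Definition FDFW_directions (R : realType) (n : nat) : fw_method R n :=
  fun Omega x g => [set d | exists dA dFW : 'rV[R]_n,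
    [/\ in_face_directions Omega x g dA, FW_directions Omega x g dFW &
        argmax [set dA; dFW] (fun d' => dot g d') d]].

Definition FW (R : realType) (n : nat) : fw_method R n :=
  zero_if_stationary (@FW_directions R n).

Definition FDFW (R : realType) (n : nat) : fw_method R n :=
  zero_if_stationary (@FDFW_directions R n).

(* Infima are taken in \bar R, where the empty infimum is +oo. *)
Definition DSB (R : realType) (n : nat) (M : fw_method R n)
    (Omega : set 'rV[R]_n) (x g : 'rV[R]_n) : \bar R :=
  if pi_ Omega x g == 0 then 1%E
  else ereal_inf [set (dot g d / (pi_ Omega x g * enorm d))%:E
                 | d in M Omega x g].

Definition SB (R : realType) (n : nat) (M : fw_method R n)
    (Omega P : set 'rV[R]_n) : \bar R :=
  ereal_inf [set DSB M Omega x g | x in P & g in [set: 'rV[R]_n]].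

(* Main.v *)
Require Import Defs.
From mathcomp Require Import all_boot all_order all_algebra.
From mathcomp Require Import all_classical all_reals all_analysis.
From mathcomp Require Import ring lra.
Import Order.TTheory GRing.Theory Num.Theory.
Import numFieldNormedType.Exports.

(** Write [c = mu / (2 * L)], [Omega] for the sublevel set [h <= a], and let
    [pi] be the norm of the projection of [g] on the tangent cone at [x].  The
    curvature of [h] sandwiches [Omega] between two balls at each point [e] of
    the level set [h = a]: with [q] the gradient of [h] at [e], smoothness puts
    the ball of centre [e - q / L] and radius [|q| / L] inside [Omega]
    ([sublevel_sphere]), and strong convexity puts [Omega] inside the ball of
    centre [e - q / mu] and radius [|q| / mu] ([sublevel_ball]).

    Frank-Wolfe at a point [x] of the level set ([FW_slope]).  Let [s] maximise
    [<g, .>] on [Omega], so that [g = l q] with [l >= 0] and [q] the gradient of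
    [h] at [s] ([linear_max_normal]).  The outer ball at [s] gives
    [<g, s - x> >= l (mu / 2) |s - x|^2].  On the other hand, the gradient [p]
    at [x] is normal to [Omega], so subtracting a nonnegative multiple of [p]
    from [g] can only leave a vector at least as long as the projection
    ([norm_proj_le_polar]): [pi <= |g - l p| = l |q - p| <= l L |s - x|].
    Dividing the two bounds gives exactly [c].  Taking the multiple [l p], rather
    than the best multiple of [p], is what makes the Lipschitz bound on the
    gradient applicable.

    In-face directions.  As [Omega] is strictly convex, the minimal face of a
    point of the level set is that point ([minimal_face_level]), whose away
    direction is zero, so the Frank-Wolfe case applies.  At an interior point the
    minimal face is [Omega] ([minimal_face_interior]); with [w] a minimiser of
    [<g, .>], the better of [s - x] and [x - w] gains at least half of the width
    [<g, s - w>].  If [e] is the one of [s], [w] defining the chosen direction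
    [d], the inner ball at [e] bounds the width from below by [2 |g| |q| / L]
    ([width_ge]), the outer ball at [e] bounds [|d|] from above by [2 |q| / mu]
    ([sublevel_radius]), and [pi <= |g|] ([half_width_slope]). *)

Set Implicit Arguments.
Unset Strict Implicit.
Unset Printing Implicit Defensive.

Local Open Scope classical_set_scope.
Local Open Scope ring_scope.

(** * Euclidean geometry of row vectors *)

Section Euclidean.
Variables (R : realType) (n : nat).
Implicit Types (u v w : 'rV[R]_n) (t : R).

Lemma dotC u v : dot u v = dot v u.
Proof. by apply: eq_bigr => i _; rewrite mulrC. Qed.

Lemma dotDl u v w : dot (u + v) w = dot u w + dot v w.
Proof. by rewrite -big_split; apply: eq_bigr => i _; rewrite mxE mulrDl. Qed.

Lemma dotZl t u v : dot (t *: u) v = t * dot u v.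
Proof. by rewrite mulr_sumr; apply: eq_bigr => i _; rewrite mxE mulrA. Qed.

Lemma dotNl u v : dot (- u) v = - dot u v.
Proof. by rewrite -scaleN1r dotZl mulN1r. Qed.

Lemma dotDr u v w : dot u (v + w) = dot u v + dot u w.
Proof. by rewrite dotC dotDl !(dotC u). Qed.

Lemma dotZr t u v : dot u (t *: v) = t * dot u v.
Proof. by rewrite dotC dotZl dotC. Qed.

Lemma dotNr u v : dot u (- v) = - dot u v.
Proof. by rewrite dotC dotNl dotC. Qed.

Definition dotE := (dotDl, dotDr, dotNl, dotNr, dotZl, dotZr).

Lemma dot0r u : dot u 0 = 0.
Proof. by rewrite -(scale0r u) dotZr mul0r. Qed.

Lemma dot0l u : dot 0 u = 0.
Proof. by rewrite dotC dot0r. Qed.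

Lemma dot_ge0 u : 0 <= dot u u.
Proof. by apply: sumr_ge0 => i _; rewrite -expr2 sqr_ge0. Qed.

Lemma enorm_ge0 u : 0 <= enorm u.
Proof. exact: sqrtr_ge0. Qed.

Lemma sqr_enorm u : enorm u ^+ 2 = dot u u.
Proof. by rewrite sqr_sqrtr// dot_ge0. Qed.

Lemma enorm0 : enorm (0 : 'rV[R]_n) = 0.
Proof. by rewrite /enorm dot0r sqrtr0. Qed.

Lemma enorm0_eq0 u : enorm u = 0 -> u = 0.
Proof.
move=> u0; have : dot u u = 0 by rewrite -sqr_enorm u0 expr0n.
move/eqP; rewrite psumr_eq0; last by move=> i _; rewrite -expr2 sqr_ge0.
move=> /allP u_i; apply/rowP => i; rewrite mxE.
by have := u_i i (mem_index_enum i); rewrite /= mulf_eq0 orbb => /eqP.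
Qed.

Lemma enorm_gt0 u : u != 0 -> 0 < enorm u.
Proof.
move=> u0; rewrite lt_def enorm_ge0 andbT.
by apply: contra_neq u0; exact: enorm0_eq0.
Qed.

Lemma enormZ t u : enorm (t *: u) = `|t| * enorm u.
Proof.
apply/eqP; rewrite -(@eqrXn2 _ 2) ?mulr_ge0 ?enorm_ge0 ?normr_ge0//.
by rewrite exprMn !sqr_enorm !dotE real_normK ?num_real// mulrA.
Qed.

Lemma enormN u : enorm (- u) = enorm u.
Proof. by rewrite -scaleN1r enormZ normrN normr1 mul1r. Qed.

Lemma enormB u v : enorm (u - v) = enorm (v - u).
Proof. by rewrite -enormN opprB. Qed.

(** Both the Cauchy-Schwarz inequality and its equality case can be read off
    this identity, since its left-hand side is a square. *)
Lemma sqr_enorm_cross u v :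
  enorm (enorm u *: v - enorm v *: u) ^+ 2 =
    2 * (enorm u * enorm v) * (enorm u * enorm v - dot u v).
Proof.
rewrite sqr_enorm !dotE -!sqr_enorm (dotC v u).
by ring.
Qed.

Lemma cauchy_schwarz u v : dot u v <= enorm u * enorm v.
Proof.
have cross := sqr_ge0 (enorm (enorm u *: v - enorm v *: u)).
rewrite sqr_enorm_cross in cross.
have [->|/enorm_gt0 u0] := eqVneq u 0.
  by rewrite dot0l mulr_ge0 ?enorm_ge0.
have [->|/enorm_gt0 v0] := eqVneq v 0; first by rewrite dot0r mulr_ge0 ?enorm_ge0.
by move: cross; rewrite pmulr_rge0 ?subr_ge0// !mulr_gt0.
Qed.

Lemma cauchy_schwarz_eq u v :
  enorm u * enorm v <= dot u v -> enorm u *: v = enorm v *: u.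
Proof.
move=> uv; apply/subr0_eq/enorm0_eq0/eqP; rewrite -sqrf_eq0 sqr_enorm_cross.
rewrite (_ : _ - _ = 0) ?mulr0//; apply/eqP.
by rewrite subr_eq0 eq_le uv cauchy_schwarz.
Qed.

Lemma dot_continuous u : continuous (dot u).
Proof.
have term i : continuous (fun v : 'rV[R]_n => u 0 i * v 0 i).
  move=> v; apply: continuousM; first exact: cst_continuous.
  exact: coord_continuous.
by apply: continuous_big => [|i _]; [exact: add_continuous|exact: term].
Qed.

End Euclidean.

(** * Projection on the tangent cone *)

Section Projection.
Variables (R : realType) (n : nat).
Implicit Types (Omega : set 'rV[R]_n) (x y z g p : 'rV[R]_n) (t : R).

Lemma closed_halfspace p : closed [set z : 'rV[R]_n | dot p z <= 0].
Proof.
by apply: (@closed_comp _ _ (dot p) [set r | r <= 0]);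
  [move=> ? _; exact: dot_continuous|exact: closed_le].
Qed.

Lemma tangent_coneZ Omega x z t : 0 <= t ->
  tangent_cone Omega x z -> tangent_cone Omega x (t *: z).
Proof.
move=> t0 Tz B /(scaler_continuous (k := t)) /Tz [_ [[r r0 [y Oy <-]]] Bry].
exists (t *: (r *: (y - x))); split=> //.
by exists (t * r); [exact: mulr_ge0|exists y; rewrite ?scalerA].
Qed.

Lemma tangent_cone_polar Omega x p : (forall y, Omega y -> dot p (y - x) <= 0) ->
  tangent_cone Omega x `<=` [set z | dot p z <= 0].
Proof.
move=> pO z Tz; apply: (@closed_halfspace p); move: z Tz.
apply: closure_subset => _ [t t0 [y Oy <-]] /=.
by rewrite dotZr mulr_ge0_le0// pO.
Qed.

Lemma norm_proj_ge0 Omega x g : 0 <= pi_ Omega x g.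
Proof. exact: enorm_ge0. Qed.

(** For the projection [z] of [g] on the cone, [|z|^2 <= <g, z>] because [z] can
    be rescaled within the cone, while [<p, z> <= 0] as [p] is in the polar cone;
    hence [|z|^2 <= <g - t p, z> <= |g - t p| |z|]. *)
Lemma norm_proj_le_polar Omega x g p t : 0 <= t ->
  (forall y, Omega y -> dot p (y - x) <= 0) ->
  pi_ Omega x g <= enorm (g - t *: p).
Proof.
move=> t0 pO; rewrite /pi_ /Defs.proj.
(* If [z] is nonzero it is not the default value of [xget]. *)
set z := xget _ _; have [z0|z0] := eqVneq z 0.
  by rewrite z0 enorm0 enorm_ge0.
have [Tz zmin] : argmin (tangent_cone Omega x) (fun p => enorm (g - p)) z.
  by move: z0; rewrite /z; case: xgetP => [_ ->//|_]; rewrite eqxx.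
have zz : dot z z <= dot g z.
  (* Optimality of [z] among its own nonnegative multiples. *)
  have opt r : 0 <= r -> (r - 1) * 2 * dot g z <= (r ^+ 2 - 1) * dot z z.
    move=> r0; have := zmin _ (tangent_coneZ r0 Tz).
    rewrite -ler_sqr ?nnegrE ?enorm_ge0// !sqr_enorm !dotE (dotC z g); lra.
  have zgt0 : 0 < dot z z by rewrite -sqr_enorm exprn_gt0 ?enorm_gt0.
  have gz0 : 0 <= dot g z by have := opt 0 (lexx _); lra.
  (* The multiple of [z] closest to [g]. *)
  have := opt (dot g z / dot z z) (divr_ge0 gz0 (ltW zgt0)).
  set r := _ / _; have -> : dot g z = r * dot z z by rewrite divfK ?gt_eqF.
  nra.
have pz : dot p z <= 0 by exact: tangent_cone_polar pO _ Tz.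
have := cauchy_schwarz (g - t *: p) z; rewrite !dotE => cs.
rewrite -(ler_pM2r (enorm_gt0 z0)) -expr2 sqr_enorm.
nra.
Qed.

End Projection.

(** * Quadratic bounds from smoothness and strong convexity *)

Section Smooth.
Variables (R : realType) (n : nat).
Implicit Types (h : 'rV[R]_n -> R) (x y v : 'rV[R]_n) (t L : R).

Lemma deriveE_gradient h x v : differentiable h x ->
  'D_v h x = dot (gradient h x) v.
Proof.
move=> dh; rewrite deriveE// {1}(row_sum_delta v) linear_sum.
by apply: eq_bigr => i _; rewrite linearZ mxE deriveE// mulrC.
Qed.

Lemma is_derive_line h x v t : differentiable h (x + t *: v) ->
  is_derive t 1 (fun r : R => h (x + r *: v)) (dot (gradient h (x + t *: v)) v).
Proof.
move=> dh; rewrite -deriveE_gradient//.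
have quotE :
    (fun r : R => r^-1 *: (((fun r : R => h (x + r *: v)) \o shift t) (r *: 1)
      - h (x + t *: v))) =
    (fun r => r^-1 *: ((h \o shift (x + t *: v)) (r *: v) - h (x + t *: v))).
  apply/funext => r /=; congr (_ *: (h _ - _)).
  by rewrite [r *: 1]mulr1 scalerDl addrCA.
have dv := @diff_derivable _ _ _ _ _ v dh.
by apply: DeriveDef; [rewrite /derivable quotE|rewrite /derive quotE].
Qed.

(** The difference of the two sides along the segment, as a function of
    [t] in [0, 1], has nonpositive derivative by the Lipschitz bound. *)
Lemma smooth_upper h L x v : lipschitz_gradient L h ->
  h (x + v) <= h x + dot (gradient h x) v + L / 2 * enorm v ^+ 2.
Proof.
move=> [dh lip]; set q := gradient h x; set C := L / 2 * _.
pose phi : R -> R :=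
  (fun t : R => h (x + t *: v)) - ((dot q v) \*: id + C \*: (id ^+ 2)).
pose dphi t := dot (gradient h (x + t *: v)) v - (dot q v + C * (2 * t)).
have phiD t : is_derive t 1 phi (dphi t).
  have hD := is_derive_line (dh (x + t *: v)).
  apply: is_derive_eq; rewrite /dphi /GRing.scale/= expr1; ring.
have phi_cont : {within `[0, 1], continuous phi}.
  apply: continuous_subspaceT => t.
  by apply: differentiable_continuous; apply/derivable1_diffP; case: (phiD t).
have [c] := MVT ltr01 (fun t _ => phiD t) phi_cont.
rewrite in_itv/= => /andP[c0 c1].
rewrite subr0 mulr1 /phi !fctE /= !scale0r scale1r addr0.
rewrite /GRing.scale/= !expr1n expr0n/= => phi1.
have : dphi c <= 0.
  have := cauchy_schwarz (gradient h (x + c *: v) - q) v.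
  have := lip (x + c *: v) x; rewrite (addrAC x) subrr add0r enormZ gtr0_norm//.
  rewrite !dotE -/q => le1 le2; have := enorm_ge0 v.
  rewrite /dphi /C; nra.
rewrite -phi1; lra.
Qed.

Lemma lipschitz_gradientN h L :
  lipschitz_gradient L h -> lipschitz_gradient L (- h).
Proof.
move=> [dh lip]; split=> [x|x y]; first exact: differentiableN.
have gN z : gradient (- h) z = - gradient h z.
  by apply/rowP => i; rewrite !mxE deriveN//; exact: diff_derivable.
by rewrite !gN -opprD enormN.
Qed.

Lemma smooth_lower h L x v : lipschitz_gradient L h ->
  h x + dot (gradient h x) v - L / 2 * enorm v ^+ 2 <= h (x + v).
Proof.
move=> hL; have := smooth_upper x v (lipschitz_gradientN hL).
have -> : gradient (- h) x = - gradient h x.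
  by apply/rowP => i; rewrite !mxE deriveN//; apply: diff_derivable; case: hL.
rewrite dotNl !fctE; lra.
Qed.

(** Convexity at parameter [t] and [smooth_lower] differ by a term of order
    [t^2]; after division by [t], letting [t] tend to 0 gives the bound. *)
Lemma strongly_convex_lower h L mu x y :
  strongly_convex mu h -> lipschitz_gradient L h ->
  h x + dot (gradient h x) (y - x) + mu / 2 * enorm (y - x) ^+ 2 <= h y.
Proof.
move=> sc hL; set q := gradient h x; set e := enorm (y - x) ^+ 2.
have e0 : 0 <= e by rewrite exprn_ge0 ?enorm_ge0.
pose D := dot q (y - x) + mu / 2 * e - (h y - h x).
pose K := (`|L| + `|mu|) / 2 * e.
have step t : 0 < t <= 1 -> D <= t * K.
  move=> /andP[t0 t1]; have := sc y x t (ltW t0) t1.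
  have -> : t *: y + (1 - t) *: x = x + t *: (y - x).
    by rewrite scalerBl scale1r scalerBr addrCA.
  have := smooth_lower x (t *: (y - x)) hL.
  rewrite -/q -/e enormZ (gtr0_norm t0) dotZr exprMn -/e => lo up.
  rewrite -(ler_pM2l t0) /D /K.
  have te0 : 0 <= t ^+ 2 * e by rewrite mulr_ge0 ?sqr_ge0.
  have := ler_wpM2r te0 (lerD (ler_norm L) (ler_norm mu)).
  lra.
suff : D <= 0 by rewrite /D; lra.
rewrite leNgt; apply/negP => D0.
have K0 : 0 <= K by rewrite /K mulr_ge0// divr_ge0 ?addr_ge0.
(* Some [t] in [0, 1] with [t K < D]. *)
pose t := D / (D + 2 * K).
have tE : t * (D + 2 * K) = D by rewrite /t divfK// gt_eqF//; lra.
have tin : 0 < t <= 1.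
  by rewrite /t divr_gt0//=; [rewrite ler_pdivrMr//|]; lra.
have := step t tin; move/andP: tin => [t0 t1]; nra.
Qed.

(** In positive dimension there is a nonzero vector [y]; comparing the
    gradients at [y] and [0] gives [mu |y|^2 <= L |y|^2].  This makes [L]
    positive and [mu / (2 * L)] at most 1. *)
Lemma strong_convexity_le_smoothness h L mu : (0 < n)%N ->
  strongly_convex mu h -> lipschitz_gradient L h -> mu <= L.
Proof.
move=> n0 sc hL; pose y : 'rV[R]_n := const_mx 1.
have y0 : y != 0.
  by apply/eqP => /rowP /(_ (Ordinal n0)); rewrite !mxE => /eqP; rewrite oner_eq0.
have := strongly_convex_lower 0 y sc hL; have := strongly_convex_lower y 0 sc hL.
rewrite enormB !(subr0, sub0r) dotNr.
have := cauchy_schwarz (gradient h y - gradient h 0) y.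
have := hL.2 y 0; rewrite subr0 !dotE => lip cs l1 l2.
have := enorm_gt0 y0; set e := enorm y in lip cs l1 l2 * => e0.
rewrite -(ler_pM2r (mulr_gt0 e0 e0)); nra.
Qed.

Lemma smooth_continuous h L : lipschitz_gradient L h -> continuous h.
Proof. by move=> [dh _] x; exact: differentiable_continuous. Qed.

End Smooth.

(** * Reduction of slope bounds to inequalities on directions *)

Section Reductions.
Variables (R : realType) (n : nat) (Omega : set 'rV[R]_n).
Implicit Types (x s g : 'rV[R]_n) (M : fw_method R n) (c : R).

(** If no point of [Omega] improved on [x], then [g] itself would lie in the
    polar of the tangent cone and its projection would vanish. *)
Lemma FW_gain_gt0 x s g : pi_ Omega x g != 0 ->
  argmax Omega (fun y => dot y g) s -> 0 < dot g (s - x).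
Proof.
move=> pi0 [_ smax]; rewrite ltNge; apply: contra_neqN pi0 => gain.
have := @norm_proj_le_polar _ _ Omega x g g 1 ler01; rewrite scale1r subrr.
rewrite enorm0 => pi0; apply/eqP; rewrite eq_le norm_proj_ge0 andbT.
apply: pi0 => y /smax.
by rewrite !(dotC _ g) => ys; move: gain; rewrite !dotE; lra.
Qed.

Lemma norm_proj_le x g : pi_ Omega x g <= enorm g.
Proof.
have := @norm_proj_le_polar _ _ Omega x g 0 0 (lexx _).
by rewrite scaler0 subr0; apply=> y _; rewrite dot0l.
Qed.

(** A positive gain rules out the zero direction, for which the quotient in
    [DSB] would take the value 0. *)
Lemma DSB_ge M c x g : c <= 1 ->
  (pi_ Omega x g != 0 -> forall d, M Omega x g d ->
     0 < dot g d /\ c * (pi_ Omega x g * enorm d) <= dot g d) ->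
  (c%:E <= DSB M Omega x g)%E.
Proof.
move=> c1 slope; rewrite /DSB; case: ifPn => [_|pi0]; first by rewrite lee_fin.
apply/ereal_infP => _ [d Md <-]; have [gd0 gd] := slope pi0 d Md.
have d0 : d != 0 by apply: contraTneq gd0 => ->; rewrite dot0r ltxx.
have pi_gt0 : 0 < pi_ Omega x g by rewrite lt_def pi0 norm_proj_ge0.
by rewrite lee_fin ler_pdivlMr// mulr_gt0// enorm_gt0.
Qed.

End Reductions.

(** * Sublevel sets of smooth strongly convex functions *)

Section Sublevel.
Variables (R : realType) (n : nat) (h : 'rV[R]_n -> R) (mu L a : R).
Hypotheses (mu_gt0 : 0 < mu) (L_gt0 : 0 < L).
Hypotheses (h_sc : strongly_convex mu h) (h_lip : lipschitz_gradient L h).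
Implicit Types (x y s w e g u v d : 'rV[R]_n).

Let Omega : set 'rV[R]_n := [set x | h x <= a].
Local Notation "'grad' x" := (gradient h x) (at level 10, x at level 9).

(** The point moves on the sphere of centre [e - q / L] and radius [|q| / L],
    [q] being the gradient at [e]: there the quadratic upper bound of [h] around
    [e] takes the value [h e]. *)
Lemma sublevel_sphere e u : h e <= a -> enorm u = enorm (grad e) ->
  Omega (e + L^-1 *: (u - grad e)).
Proof.
move=> ea uq; apply: le_trans (smooth_upper _ _ h_lip) _.
apply: le_trans ea.
have uu : dot u u = dot (grad e) (grad e) by rewrite -!sqr_enorm uq.
rewrite sqr_enorm !dotE (dotC u (grad e)) uu -subr_ge0 le_eqVlt; apply/orP; left.
by apply/eqP; field; rewrite gt_eqF.
Qed.

(** This says that [y] lies in the ball of centre [e - q / mu] and radius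
    [|q| / mu], with [q] the gradient at [e]. *)
Lemma sublevel_ball e y : h y <= h e ->
  mu / 2 * enorm (y - e) ^+ 2 <= dot (grad e) (e - y).
Proof.
move=> ye; have := strongly_convex_lower e y h_sc h_lip.
by rewrite -(opprB y e) dotNr; lra.
Qed.

Lemma sublevel_radius e y : h y <= h e -> mu * enorm (y - e) <= 2 * enorm (grad e).
Proof.
move=> ye; have := sublevel_ball ye; have := cauchy_schwarz (grad e) (e - y).
rewrite (enormB e); have [->|/enorm_gt0] := eqVneq (y - e) 0.
  by move=> _ _; rewrite enorm0 mulr0 mulr_ge0 ?enorm_ge0.
by move=> d0 cs ball; rewrite -(ler_pM2r d0); lra.
Qed.

Lemma sublevel_step x v : h x < a -> exists2 t, 0 < t & Omega (x + t *: v).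
Proof.
move=> xa; pose K := `|dot (grad x) v| + L / 2 * enorm v ^+ 2.
have vv0 : 0 <= L / 2 * enorm v ^+ 2.
  by rewrite mulr_ge0 ?exprn_ge0 ?enorm_ge0// divr_ge0 ?ltW.
have K0 : 0 <= K by rewrite addr_ge0.
have D0 : 0 < a - h x + K by lra.
(* This choice gives [t <= 1] and [t K <= a - h x], and [h] increases by at most
   [t K] from [x] to [x + t v] as soon as [t <= 1]. *)
pose t := (a - h x) / (a - h x + K).
have tE : t * (a - h x + K) = a - h x by rewrite divfK ?gt_eqF.
have t0 : 0 < t by rewrite divr_gt0// subr_gt0.
have t1 : t <= 1 by rewrite ler_pdivrMr//; lra.
exists t => //; apply: le_trans (smooth_upper _ _ h_lip) _.
rewrite dotZr enormZ (gtr0_norm t0) exprMn.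
have t2 : t ^+ 2 * (L / 2 * enorm v ^+ 2) <= t * (L / 2 * enorm v ^+ 2).
  by rewrite ler_wpM2r// expr2 ler_piMl// ltW.
have := ler_wpM2l (ltW t0) (ler_norm (dot (grad x) v)).
have ta : 0 <= t * (a - h x) by rewrite mulr_ge0// ltW// subr_gt0.
by move: tE; rewrite mulrDr /K mulrDr; lra.
Qed.

Lemma linear_max_level s g : g != 0 -> argmax Omega (fun y => dot y g) s -> h s = a.
Proof.
move=> g0 [sO smax]; apply/eqP; rewrite eq_le sO leNgt /=; apply/negP => sa.
have [t t0 /smax] := sublevel_step g sa; rewrite dotDl dotZl -sqr_enorm.
by apply/negP; rewrite -ltNge ltrDl mulr_gt0// exprn_gt0// enorm_gt0.
Qed.

Lemma level_gradient_neq0 e : inf (range h) < a -> h e = a -> grad e != 0.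
Proof.
move=> ha ea; apply: contraTneq ha => q0; rewrite -leNgt.
apply: lb_le_inf; first by exists (h e), e.
move=> _ [y _ <-]; have := strongly_convex_lower e y h_sc h_lip.
rewrite q0 dot0l ea; have : 0 <= mu / 2 * enorm (y - e) ^+ 2.
  by rewrite mulr_ge0 ?exprn_ge0 ?enorm_ge0// divr_ge0 ?ltW.
by lra.
Qed.

(** Maximality of [s] against the point of the inner ball that is extreme in
    the direction [g] is the equality case of Cauchy-Schwarz between [g] and
    the gradient. *)
Lemma linear_max_normal s g : grad s != 0 ->
  argmax Omega (fun y => dot y g) s -> exists2 l, 0 <= l & g = l *: grad s.
Proof.
move=> q0 [sO smax]; have qn := enorm_gt0 q0.
have [->|/enorm_gt0 gn] := eqVneq g 0; first by exists 0; rewrite ?scale0r.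
have uq : enorm ((enorm (grad s) / enorm g) *: g) = enorm (grad s).
  by rewrite enormZ ger0_norm ?divfK ?gt_eqF// divr_ge0 ?ltW.
have := smax _ (sublevel_sphere sO uq).
rewrite dotDl gerDl dotZl pmulr_rle0 ?invr_gt0// !dotE subr_le0 -sqr_enorm.
rewrite expr2 mulrA divfK ?gt_eqF// => /cauchy_schwarz_eq qg.
exists (enorm g / enorm (grad s)); first by rewrite divr_ge0 ?ltW.
by rewrite mulrC -scalerA -qg scalerA mulVf ?gt_eqF// scale1r.
Qed.

(** The gain is at least [l (mu / 2) |s - x|^2] and the projection is at most
    [l L |s - x|], for the same multiplier [l]. *)
Lemma FW_slope x s g : inf (range h) < a -> h x = a -> pi_ Omega x g != 0 ->
  argmax Omega (fun y => dot y g) s ->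
  mu / (2 * L) * (pi_ Omega x g * enorm (s - x)) <= dot g (s - x).
Proof.
move=> ha xa pi0 smax.
have g0 : g != 0.
  by apply: contraTneq (FW_gain_gt0 pi0 smax) => ->; rewrite dot0l ltxx.
have sa := linear_max_level g0 smax.
have [l l0 gE] := linear_max_normal (level_gradient_neq0 ha sa) smax.
have piL : pi_ Omega x g <= l * (L * enorm (s - x)).
  (* The gradient at [x] is an outer normal of [Omega] at [x]. *)
  have polar y : Omega y -> dot (grad x) (y - x) <= 0.
    rewrite /Omega/= -xa => /sublevel_ball.
    rewrite -(opprB y x) dotNr; have : 0 <= mu / 2 * enorm (y - x) ^+ 2.
      by rewrite mulr_ge0 ?exprn_ge0 ?enorm_ge0// divr_ge0 ?ltW.
    lra.
  apply: le_trans (norm_proj_le_polar g l0 polar) _.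
  by rewrite gE -scalerBr enormZ ger0_norm// ler_wpM2l// h_lip.2.
have ball : mu / 2 * enorm (s - x) ^+ 2 <= dot (grad s) (s - x).
  by rewrite (enormB s); apply: sublevel_ball; rewrite xa sa.
rewrite {2}gE dotZl; apply: le_trans (ler_wpM2l l0 ball).
have -> : l * (mu / 2 * enorm (s - x) ^+ 2) =
    mu / (2 * L) * (l * (L * enorm (s - x)) * enorm (s - x)).
  by field; rewrite gt_eqF.
apply: ler_wpM2l; first by rewrite divr_ge0 ?mulr_ge0 ?ltW.
by rewrite ler_wpM2r ?enorm_ge0.
Qed.

(** The linear form [<g, .>] varies by twice [|g|] times the radius of the inner
    ball at [e]. *)
Lemma width_ge e s w g : h e <= a -> argmax Omega (fun y => dot y g) s ->
  argmin Omega (fun y => dot g y) w ->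
  2 * (enorm g * enorm (grad e)) <= L * dot g (s - w).
Proof.
move=> ea [_ smax] [_ wmin].
have [->|/enorm_gt0 gn] := eqVneq g 0.
  by rewrite dot0l mulr0 enorm0 mul0r mulr0.
pose r := enorm (grad e) / enorm g.
have r0 : 0 <= r by rewrite divr_ge0 ?enorm_ge0.
have uq : enorm (r *: g) = enorm (grad e).
  by rewrite enormZ ger0_norm// divfK ?gt_eqF.
have uNq : enorm (- (r *: g)) = enorm (grad e) by rewrite enormN.
have up := smax _ (sublevel_sphere ea uq).
have lo := wmin _ (sublevel_sphere ea uNq).
have rgg : r * dot g g = enorm g * enorm (grad e).
  by rewrite -sqr_enorm expr2 mulrA divfK ?gt_eqF// mulrC.
have -> : 2 * (enorm g * enorm (grad e)) = L * (2 * L^-1 * (r * dot g g)).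
  by rewrite rgg; field; rewrite gt_eqF.
by rewrite ler_pM2l//; move: up lo; rewrite !(dotC _ g) !dotE; lra.
Qed.

(** The level point [e] is kept general so that the lemma serves both the
    Frank-Wolfe direction, with [e := s], and the away direction, with
    [e := w]. *)
Lemma half_width_slope x e s w g d : h x <= a -> h e = a ->
  argmax Omega (fun y => dot y g) s -> argmin Omega (fun y => dot g y) w ->
  enorm d = enorm (x - e) -> dot g (s - w) <= 2 * dot g d ->
  mu / (2 * L) * (pi_ Omega x g * enorm d) <= dot g d.
Proof.
move=> xa ea smax wmin de half.
have eO : h e <= a by rewrite ea.
have wid := width_ge eO smax wmin.
have := @sublevel_radius e x; rewrite ea -de => /(_ xa) rad.
have wid2 : enorm g * (2 * enorm (grad e)) <= 2 * L * dot g d.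
  by have := ler_wpM2l (ltW L_gt0) half; lra.
rewrite mulrAC ler_pdivrMr ?mulr_gt0// (mulrC (dot g d)).
apply: le_trans wid2; rewrite mulrCA.
have mud : 0 <= mu * enorm d by rewrite mulr_ge0 ?enorm_ge0 ?ltW.
exact: ler_pM (norm_proj_ge0 _ _ _) mud (norm_proj_le _ _ _) rad.
Qed.

Lemma sublevel_self_face : is_face Omega Omega.
Proof.
split=> //; apply/convex_setW => y z yO zO t t0 t1.
move: yO zO; rewrite !inE /Omega/= => yO zO.
apply: le_trans (h_sc y z (ltW t0) (ltW t1)) _.
have : 0 <= mu / 2 * t%:num * (1 - t%:num) * enorm (y - z) ^+ 2.
  by rewrite !mulr_ge0 ?invr_ge0 ?exprn_ge0 ?enorm_ge0 ?subr_ge0// ltW.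
nra.
Qed.

Lemma minimal_face_sub x : Omega x -> minimal_face Omega x `<=` Omega.
Proof. by move=> xO; apply: bigcap_inf; split=> //; exact: sublevel_self_face. Qed.

(** An interior point [x] lies strictly between any [y] in [Omega] and a point
    of [Omega] slightly beyond [x], so every face through [x] contains [y]. *)
Lemma minimal_face_interior x : h x < a -> minimal_face Omega x = Omega.
Proof.
move=> xa; apply/seteqP; split; first exact/minimal_face_sub/ltW.
move=> y yO F [[FO _ Fext] Fx]; have [t t0 zO] := sublevel_step (x - y) xa.
have t1 : 0 < 1 + t by lra.
have [] // := Fext y (x + t *: (x - y)) (t / (1 + t)) yO zO.
- by rewrite divr_gt0.
- by rewrite ltr_pdivrMr//; lra.
suff -> : (t / (1 + t)) *: y + (1 - t / (1 + t)) *: (x + t *: (x - y)) = x by [].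
by apply/rowP => i; rewrite !mxE; field; rewrite gt_eqF.
Qed.

(** By strict convexity a level point is extreme, hence a face by itself. *)
Lemma minimal_face_level x : h x = a -> minimal_face Omega x `<=` [set x].
Proof.
move=> xa; apply: bigcap_inf; split=> //; split.
- by move=> _ ->; rewrite /Omega/= xa.
- apply/convex_setW => y z; rewrite !inE /= => -> -> t _ _.
  by rewrite convmm inE.
move=> y z t yO zO t0 t1 /= xE.
suff yz : y = z by move: xE; rewrite yz -scalerDl addrC subrK scale1r.
have [//|yz] := eqVneq y z; exfalso; move: xa; rewrite -xE.
have := h_sc y z (ltW t0) (ltW t1).
have : 0 < mu / 2 * t * (1 - t) * enorm (y - z) ^+ 2.
  by rewrite !mulr_gt0 ?invr_gt0 ?exprn_gt0 ?enorm_gt0 ?subr_gt0 ?subr_eq0.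
move: yO zO; rewrite /Omega/= => yO zO pos le.
nra.
Qed.

Lemma FDFW_slope x g d : inf (range h) < a -> Omega x -> pi_ Omega x g != 0 ->
  FDFW_directions Omega x g d ->
  0 < dot g d /\ mu / (2 * L) * (pi_ Omega x g * enorm d) <= dot g d.
Proof.
move=> ha xO pi0 [dA [dFW [[w wmin <-] [s smax <-] [dd dmax]]]].
have gain := FW_gain_gt0 pi0 smax.
have gdFW := dmax (s - x) (or_intror erefl).
have gdA := dmax (x - w) (or_introl erefl).
have gd := lt_le_trans gain gdFW; split=> //.
have g0 : g != 0 by apply: contraTneq gain => ->; rewrite dot0l ltxx.
have sa := linear_max_level g0 smax.
have [xa|xa] := eqVneq (h x) a.
  (* The away direction is zero here, so it cannot be the chosen one. *)
  case: dd => [dw|->]; last exact: FW_slope.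
  move: gd; rewrite dw; case: wmin => /(minimal_face_level xa) -> _.
  by rewrite subrr dot0r ltxx.
rewrite minimal_face_interior in wmin; last by rewrite lt_neqAle xa.
have half : dot g (s - w) <= 2 * dot g d by move: gdFW gdA; rewrite !dotE; lra.
case: dd => dE.
  (* A minimiser for [g] is a maximiser for [- g]. *)
  have wa : h w = a.
    apply: (@linear_max_level w (- g)); first by rewrite oppr_eq0.
    split; first exact: wmin.1.
    by move=> y /wmin.2; rewrite !dotNr !(dotC _ g) lerN2.
  by apply: half_width_slope wa smax wmin _ half; rewrite ?dE.
by apply: half_width_slope sa smax wmin _ half; rewrite ?dE 1?enormB.
Qed.

Lemma boundary_level x : boundary Omega x -> h x = a.
Proof.
move=> [xcl xint]; have hc := smooth_continuous h_lip.
have xO : Omega x.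
  have : closed Omega.
    apply: (@closed_comp _ _ h [set r | r <= a]); last exact: closed_le.
    by move=> ? _; exact: hc.
  exact.
apply/eqP; rewrite eq_le xO leNgt; apply/negP => xa; apply: xint.
have : open (h @^-1` [set r | r < a]).
  by apply: open_comp; [move=> ? _; exact: hc|exact: open_lt].
move=> /open_subsetE sub; have : h @^-1` [set r | r < a] `<=` Omega by move=> y /ltW.
by rewrite sub; exact.
Qed.

End Sublevel.

(** * The slope bounds *)

Theorem proposition6p4 (R : realType) (n : nat) (n_gt0 : (0 < n)%N)
    (h : 'rV[R]_n -> R) (mu L a : R)
    (mu_gt0 : 0 < mu)
    (h_sc : strongly_convex mu h)
    (h_lip : lipschitz_gradient L h)
    (a_gt : inf (range h) < a) :
  let Omega : set 'rV[R]_n := [set x | h x <= a] in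
  ((mu / (2 * L))%:E <= SB (@FW R n) Omega (boundary Omega))%E /\
  ((mu / (2 * L))%:E <= SB (@FDFW R n) Omega Omega)%E.
Proof.
move=> Omega; have muL := strong_convexity_le_smoothness n_gt0 h_sc h_lip.
have L_gt0 := lt_le_trans mu_gt0 muL.
have c1 : mu / (2 * L) <= 1 by rewrite ler_pdivrMr ?mulr_gt0//; lra.
split; apply/ereal_infP => _ [x xP [g _ <-]]; apply: DSB_ge => // pi0 d.
  rewrite /FW /zero_if_stationary /= (negPf pi0) => -[s smax <-].
  split; first exact: FW_gain_gt0 pi0 smax.
  exact: (FW_slope mu_gt0 L_gt0 h_sc h_lip a_gt (boundary_level h_lip xP) pi0 smax).
rewrite /FDFW /zero_if_stationary /= (negPf pi0).
exact: FDFW_slope.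
Qed.
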